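(* Define integers $C_{1^12^24^{-3}}(n)$ for $n\ge 0$ by $$\frac{(q;q)_\infty(q^2;q^2)_\infty^2}{(q^4;q^4)_\infty^3}=\sum_{n\ge0}C_{1^12^24^{-3}}(n)q^n ,$$ and let $s_{1^12^24^{-3}}(n):=\operatorname{sgn}(C_{1^12^24^{-3}}(n))$. Then for all integers $n\ge0$ $$s_{1^12^24^{-3}}(n)=\begin{cases}1&\text{if }n\equiv 0,3\pmod 4,\\ -1&\text{if }n\equiv 1,2\pmod 4.\end{cases}$$
   Context: $(a;q)_\infty:=\prod_{j=0}^{\infty}(1-aq^j)$ is the $q$-Pochhammer symbol; $\operatorname{sgn}(x)\in\{-1,0,1\}$ is the sign of the real number $x$, with $\operatorname{sgn}(0)=0$. *)

(* Defs.v *)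
From mathcomp Require Import all_boot all_order all_algebra.

Set Implicit Arguments.
Unset Strict Implicit.
Unset Printing Implicit Defensive.

Import GRing.Theory.
Local Open Scope ring_scope.

(* A formal power series in q is its coefficient function:
   [f : fps R] stands for \sum_(n >= 0) f n q^n. *)
Definition fps (R : Type) := nat -> R.

Section FormalPowerSeries.

Variable R : comUnitRingType.
Implicit Types (f g : fps R) (a q : {poly R}) (m n : nat).

Definition fps_one : fps R := fun n => (n == 0%N)%:R.

Definition fps_mul f g : fps R := fun n => \sum_(i < n.+1) f i * g (n - i)%N.

Definition fps_exp f m : fps R := iter m (fps_mul f) fps_one.

(* Coefficients of 1/f are computed by the usual recursion
     g 0 = (f 0)^-1,   g n = - (f 0)^-1 * \sum_(i < n) f (n - i) g i;
   [fps_inv_upto f m] has the correct coefficients up to index m.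
   Meaningful only when f 0 is a unit, see [fps_mulfV]. *)
Fixpoint fps_inv_upto f m : fps R :=
  if m is m'.+1 then
    fun n => if (n <= m')%N then fps_inv_upto f m' n
             else - (f 0%N)^-1 *
                  \sum_(i < m) f (m - i)%N * fps_inv_upto f m' i
  else fun=> (f 0%N)^-1.

Definition fps_inv f : fps R := fun n => fps_inv_upto f n n.

Definition fps_div f g : fps R := fps_mul f (fps_inv g).

Lemma fps_inv_uptoE f m n : (n <= m)%N -> fps_inv_upto f m n = fps_inv f n.
Proof.
elim: m => [|m IHm]; first by rewrite leqn0 => /eqP ->.
rewrite leq_eqVlt => /orP[/eqP -> //|]; rewrite ltnS => le_nm /=.
by rewrite le_nm IHm.
Qed.

Lemma fps_mulfV f : f 0%N \is a GRing.unit ->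
  fps_mul f (fps_inv f) =1 fps_one.
Proof.
move=> Uf [|n]; rewrite /fps_mul /fps_one.
  by rewrite big_ord1 /fps_inv /= divrr.
rewrite big_ord_recl /= subn0.
rewrite {1}/fps_inv [fps_inv_upto _ _ _]/= ltnn mulrA mulrN divrr // mulN1r.
apply/eqP; rewrite addrC subr_eq0; apply/eqP.
rewrite (reindex_inj rev_ord_inj) /=; apply: eq_bigr => i _.
rewrite /bump /= add1n subSS -subSn ?leq_ord // subKn ?fps_inv_uptoE ?leq_ord //.
exact: leq_trans (leq_ord i) (leqnSn n).
Qed.

(* The finite q-Pochhammer symbol (a; q)_m. *)
Definition qpoch_fin a q m : {poly R} := \prod_(j < m) (1 - a * q ^+ j).

(* The infinite q-Pochhammer symbol (a; q)_oo as a formal power series.  When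
   the base q has no constant term, the coefficient of index n in (a; q)_m does
   not depend on m > n, see [qpoch_fin_stable]. *)
Definition qpoch a q : fps R := fun n => (qpoch_fin a q n.+1)`_n.

Lemma qpoch_fin_stable a q m n :
  q`_0 = 0 -> (n < m)%N -> (qpoch_fin a q m)`_n = qpoch a q n.
Proof.
move=> q0; elim: m => // m IHm; rewrite ltnS leq_eqVlt => /orP[/eqP -> //|lt_nm].
rewrite /qpoch_fin big_ord_recr /= -/(qpoch_fin a q m) mulrBr mulr1 coefB IHm //.
suff [r ->] : exists r, q ^+ m = r * 'X^m.
  by rewrite !mulrA coefMXn lt_nm subr0.
have [r ->] : exists r, q = r * 'X.
  exists (drop_poly 1 q); rewrite -{1}(poly_take_drop 1 q) expr1.
  suff -> : take_poly 1 q = 0 by rewrite add0r.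
  by apply/polyP=> -[|i]; rewrite coef_take_poly coef0.
by exists (r ^+ m); rewrite exprMn.
Qed.

Lemma qpoch0 a q : a`_0 = 0 -> qpoch a q 0 = 1.
Proof.
by move=> a0; rewrite /qpoch /qpoch_fin big_ord1 expr0 mulr1 coefB coef1 a0 subr0.
Qed.

End FormalPowerSeries.

Declare Scope fps_scope.
Delimit Scope fps_scope with fps.
Notation "f * g" := (fps_mul f g) : fps_scope.
Notation "f ^+ m" := (fps_exp f m) : fps_scope.
Notation "f / g" := (fps_div f g) : fps_scope.
Notation "'\qpoch(' a ; q )" := (qpoch a%R q%R)
  (at level 0, a at level 99, q at level 99) : fps_scope.

(* Main.v *)
Require Import Defs.
From mathcomp Require Import all_boot all_order all_algebra.
From mathcomp Require Import zify ring qpoly.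

(** Write f_k for (q^k; q^k)_oo and f(a, b) for Ramanujan's theta series
    f(a, b) = sum over t in Z of a^(t(t+1)/2) b^(t(t-1)/2).

    The quotient f_1 f_2^2 / f_4^3 equals psi(-q) phi(-q^2) f_2 / f_4^3, where
    psi(-q) = f(-q, -q^3) = f_1 f_4 / f_2 and phi(-q^2) = f(-q^2, -q^2)
    = f_2^2 / f_4.  The parity of the summation index splits psi(-q) into
    f(q^6, q^10) - q f(q^14, q^2), so the even and the odd part of the quotient
    each carry one of these two theta series.  Put z = -q^2.  The two theta
    series are f(-z^3, -z^5) and f(-z^7, -z), and f_2 / f_4^3 is
    1 / ((z; z)_oo (z^4; z^4)_oo); hence
      f_1 f_2^2 / f_4^3 = G_3(-q^2) - q G_7(-q^2),
      G_k(z) = phi(z) f(-z^k, -z^(8-k)) / ((z; z)_oo (z^4; z^4)_oo).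
    By the Jacobi triple product, f(-z^k, -z^(8-k)) is the product of three of
    the eight factors (z^r; z^8)_oo, 1 <= r <= 8, of (z; z)_oo.  After
    cancellation G_k is phi(z), which has nonnegative coefficients, times
    reciprocals of products of 1 - z^j, so all its coefficients are nonnegative;
    they are even positive, because of the factor 1/(1 - z) in G_3, and of the
    factors 1/(1 - z^2) and phi(z) = 1 + 2z + ... in G_7.  The substitution
    z = -q^2 then makes the sign of the coefficient of q^n equal to
    (-1)^(n/2) for n even and -(-1)^((n-1)/2) for n odd, which is the claim.

    All identities are proved modulo q^(N+1), in the quotient ring
    Z[q]/(q^(N+1)): there infinite products are finite products, series of
    constant term 1 are units, and the coefficients of index at most N are not
    lost ([trunc_eqP]).  The triple product comes from its finite form
    [finite_triple_product], a case of the q-binomial theorem.  The splitting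
    of psi is [theta_trunc_dissection], the decomposition of the quotient is
    [eta_quotient_dissection], and the positivity of G_k is
    [quotient_series_gt0]. *)

Set Implicit Arguments.
Unset Strict Implicit.
Unset Printing Implicit Defensive.

Import GRing.Theory Num.Theory.
Local Open Scope ring_scope.

(** * The finite Jacobi triple product *)

Section FiniteTripleProduct.

Variable R : idomainType.
Implicit Types (a b c q x y : {poly R}) (m n k t : nat).

Lemma bin2D m n : 'C(m + n, 2) = ('C(m, 2) + 'C(n, 2) + m * n)%N.
Proof.
elim: m => [|m IHm]; first by rewrite bin0n !add0n addn0.
by rewrite addSn !binS IHm !bin1; lia.
Qed.

Lemma sqr_bin2 n : (n * n = 2 * 'C(n, 2) + n)%N.
Proof. by elim: n => // n IHn; rewrite binS bin1; lia. Qed.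

(** The Gaussian binomial coefficient, by the Pascal rule that comes from
    splitting off the first factor of \prod_j (x + y q^j). *)
Fixpoint qbinom q n k : {poly R} :=
  match n, k with
  | _, 0%N => 1
  | 0%N, _.+1 => 0
  | n'.+1, k'.+1 => qbinom q n' k' + q ^+ k * qbinom q n' k
  end.

Lemma qbinom0 q n : qbinom q n 0 = 1.
Proof. by case: n. Qed.

Lemma qbinom_small q n k : (n < k)%N -> qbinom q n k = 0.
Proof.
elim: n k => [|n IHn] [|k] //= lt_nk.
by rewrite !IHn ?mulr0 ?addr0 //; lia.
Qed.

Lemma qbinom_factorial q k j :
  qbinom q (k + j) k * qpoch_fin q q k * qpoch_fin q q j
  = qpoch_fin q q (k + j).
Proof.
have qfactS m : qpoch_fin q q m.+1 = qpoch_fin q q m * (1 - q ^+ m.+1).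
  by rewrite /qpoch_fin big_ord_recr /= -exprS.
have qfact0 : qpoch_fin q q 0 = 1 by rewrite /qpoch_fin big_ord0.
have [s] := ubnP (k + j); elim: s k j => // s IHs [|k] [|j] le_s.
- by rewrite qbinom0 qfact0 !mulr1.
- by rewrite qbinom0 qfact0 !mul1r add0n.
- have := IHs k 0%N; rewrite !addn0 qfact0 !mulr1 /= => IHk.
  by rewrite (qbinom_small _ (ltnSn k)) mulr0 addr0 !qfactS mulrA IHk //; lia.
have IHk := IHs k j.+1; have IHj := IHs k.+1 j.
rewrite addSn /= 2!mulrDl.
have -> : qbinom q (k + j.+1) k * qpoch_fin q q k.+1 * qpoch_fin q q j.+1
   = (1 - q ^+ k.+1) * qpoch_fin q q (k + j.+1).
  by rewrite -IHk ?[qpoch_fin _ _ k.+1]qfactS; [ring | lia].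
have -> : q ^+ k.+1 * qbinom q (k + j.+1) k.+1 * qpoch_fin q q k.+1
            * qpoch_fin q q j.+1
   = q ^+ k.+1 * (1 - q ^+ j.+1) * qpoch_fin q q (k + j.+1).
  rewrite addnS -addSn -IHj ?[qpoch_fin _ _ j.+1]qfactS; [ring | lia].
have -> : qpoch_fin q q (k + j.+1).+1
            = qpoch_fin q q (k + j.+1) * (1 - q ^+ k.+1 * q ^+ j.+1).
  by rewrite qfactS -exprD addSn.
ring.
Qed.

(** The factor j = 0 is split off: the other factors form the same product with
    y q in place of y, so the induction hypothesis is used at y q.  All
    exponents of q then stay natural numbers. *)
Lemma gauss_binomial q x y n :
  \prod_(j < n) (x + y * q ^+ j)
  = \sum_(k < n.+1) qbinom q n k * q ^+ 'C(k, 2) * y ^+ k * x ^+ (n - k).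
Proof.
elim: n y => [|n IHn] y.
  by rewrite big_ord0 big_ord1 /= bin0n !expr0 !mulr1.
rewrite big_ord_recl expr0 mulr1.
under eq_bigr => j _ do rewrite exprS mulrA.
rewrite IHn mulrDl [RHS]big_ord_recl /= bin0n !expr0 !mul1r.
under [in RHS]eq_bigr => k _ do
  rewrite /bump /= add1n binS bin1 subSS 3!mulrDl.
rewrite big_split /= addrA addrAC; congr (_ + _); last first.
  rewrite mulr_sumr; apply: eq_bigr => k _.
  by rewrite exprMn exprD exprS; ring.
rewrite [in LHS]big_ord_recl [in RHS]big_ord_recr /=.
rewrite (@qbinom_small q n n.+1) // !(mulr0, mul0r) addr0.
rewrite mulrDr qbinom0 bin0n !expr0 !mul1r subn0 -exprS; congr (_ + _).
rewrite mulr_sumr; apply: eq_bigr => k _.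
rewrite /bump /= add1n binS bin1 exprMn exprD (_ : n - k = (n - k.+1).+1)%N.
  by rewrite !exprS; ring.
by have := ltn_ord k; lia.
Qed.

(** With q = ab, the q-binomial theorem is applied to the 2m factors
    q^m + a q^j.  For j >= m such a factor is q^m (1 + a q^(j-m)); for j < m it
    is a q^j (1 + b q^(m-1-j)), since ab q^(m-1) = q^m.  Both sides thus contain
    the monomial q^(C(m,2) + m^2) a^m, which can be cancelled.  This homogeneous
    form avoids the negative powers of the usual Laurent polynomial identity. *)
Lemma finite_triple_product a b m : a * b != 0 ->
  qpoch_fin (- a) (a * b) m * qpoch_fin (- b) (a * b) m
  = \sum_(t < m.+1) qbinom (a * b) (m + m) (m + t)
                    * ((a * b) ^+ 'C(t, 2) * a ^+ t)
  + \sum_(t < m) qbinom (a * b) (m + m) (m - t.+1)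
                 * ((a * b) ^+ 'C(t.+1, 2) * b ^+ t.+1).
Proof.
move=> ab0; set q := a * b.
have a0 : a != 0 by apply: contraNneq ab0 => ->; rewrite mul0r.
have nz : q ^+ ('C(m, 2) + m * m) * a ^+ m != 0.
  by rewrite mulf_neq0 // expf_neq0.
apply: (mulfI nz).
have prod_geom n : \prod_(j < n) (a * q ^+ j) = q ^+ 'C(n, 2) * a ^+ n.
  elim: n => [|n IHn]; first by rewrite big_ord0 bin0n mulr1.
  by rewrite big_ord_recr /= IHn binS bin1 exprD exprS; ring.
transitivity (\prod_(j < m + m) (q ^+ m + a * q ^+ j)).
  rewrite big_split_ord /= [X in _ = X * _](reindex_inj rev_ord_inj) /=.
  rewrite /qpoch_fin.
  have -> : \prod_(j < m) (q ^+ m + a * q ^+ (m - j.+1)) =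
            \prod_(j < m) (a * q ^+ (m - j.+1)) * \prod_(j < m) (1 - - b * q ^+ j).
    rewrite -big_split; apply: eq_bigr => j _ /=.
    have {1}-> : m = ((m - j.+1) + j).+1 by have := ltn_ord j; lia.
    by rewrite exprS exprD /q; ring.
  have -> : \prod_(j < m) (a * q ^+ (m - j.+1)) = q ^+ 'C(m, 2) * a ^+ m.
    by rewrite -prod_geom [RHS](reindex_inj rev_ord_inj).
  have -> : \prod_(j < m) (q ^+ m + a * q ^+ (m + j)) =
            q ^+ (m * m) * \prod_(j < m) (1 - - a * q ^+ j).
    have -> : q ^+ (m * m) = \prod_(j < m) q ^+ m.
      by rewrite prodr_const card_ord exprM.
    by rewrite -big_split; apply: eq_bigr => j _ /=; rewrite exprD; ring.
  by rewrite exprD; ring.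
rewrite gauss_binomial -addnS big_split_ord /= addrC mulrDr; congr (_ + _).
  rewrite mulr_sumr; apply: eq_bigr => t _.
  rewrite bin2D -exprM !exprD.
  have := ltn_ord t => lt_t.
  have -> : q ^+ (m * m) = q ^+ (m * t) * q ^+ (m * (m + m - (m + t))).
    by rewrite -exprD; congr (_ ^+ _); nia.
  by ring.
rewrite (reindex_inj rev_ord_inj) mulr_sumr; apply: eq_bigr => t _ /=.
have := ltn_ord t; set k := (m - t.+1)%N => lt_t.
have Dm : m = (k + t.+1)%N by rewrite /k; lia.
rewrite -exprM; have -> : (m + m - k = m + t.+1)%N by lia.
have -> : a ^+ m = a ^+ k * a ^+ t.+1 by rewrite -exprD -Dm.
have Eq : q ^+ 'C(k, 2) * q ^+ (m * (m + t.+1))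
          = q ^+ ('C(m, 2) + m * m) * q ^+ 'C(t.+1, 2) * (a ^+ t.+1 * b ^+ t.+1).
  rewrite -exprMn -/q -!exprD; congr (_ ^+ _).
  rewrite [in 'C(m, 2)]Dm bin2D.
  by have := sqr_bin2 t.+1; nia.
by rewrite mulrAC -(mulrA (qbinom _ _ _)) Eq; ring.
Qed.

End FiniteTripleProduct.

(** A partial sum of f(a, b): the first sum has the indices t >= 0, the second one
    the indices -1 - t < 0. *)
Definition theta_trunc (S : comNzRingType) m (a b : S) :=
  \sum_(t < m) (a * b) ^+ 'C(t, 2) * a ^+ t
  + \sum_(t < m) (a * b) ^+ 'C(t.+1, 2) * b ^+ t.+1.

(** The terms of even and of odd index of f(a, b), for b = ac:
    f(a, b) = f(a^3 b, a b^3) + a f(a^5 b^3, b/a).  With b = ac, the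
    quotient b/a is the element c of the ring. *)
Lemma theta_trunc_dissection (S : comNzRingType) m (a c : S) :
  theta_trunc m.*2 a (a * c)
  = theta_trunc m (a ^+ 4 * c) (a ^+ 4 * c ^+ 3)
    + a * theta_trunc m (a ^+ 8 * c ^+ 3) c.
Proof.
have sum_double (F : nat -> S) :
    \sum_(t < m.*2) F t = \sum_(t < m) F t.*2 + \sum_(t < m) F t.*2.+1.
  elim: m => [|k IHk]; first by rewrite !big_ord0 addr0.
  by rewrite doubleS !big_ord_recr /= IHk; ring.
have bin_double k : 'C(k.*2, 2) = (4 * 'C(k, 2) + k)%N.
  by rewrite -addnn bin2D; have := sqr_bin2 k; lia.
have collect (x u y v : S) k t : x ^+ 4 = y -> x * (u * u) = v ->
    x ^+ (4 * k + t) * u ^+ t.*2 = y ^+ k * v ^+ t.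
  by move=> <- <-; rewrite exprD exprM -mul2n (exprM u) -mulrA -exprMn expr2.
rewrite /theta_trunc (sum_double (fun t => (a * (a * c)) ^+ 'C(t, 2) * a ^+ t)).
rewrite (sum_double (fun t => (a * (a * c)) ^+ 'C(t.+1, 2) * (a * c) ^+ t.+1)).
rewrite mulrDr !mulr_sumr.
(* In the second sum the bilateral index is -1 - t, so its terms of even index
   are those with t odd. *)
rewrite [_ + \sum_(t < m) _ * _ ^+ t.*2.+2]addrC.
rewrite [LHS]addrACA -!big_split.
apply: eq_bigr => t _ /=; congr (_ + _ + (_ + _)).
- by rewrite bin_double; apply: collect; ring.
- by rewrite -doubleS bin_double; apply: collect; ring.
- rewrite binS bin1 bin_double exprD (exprS a t.*2) mulrACA -exprMn mulrCA.
  by rewrite -mulrA mulrCA; congr (_ * _); apply: collect; ring.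
- rewrite !(binS, bin1) bin_double (exprD _ (4 * 'C(t, 2) + t)).
  rewrite (exprD _ 'C(t, 2) t) (exprS _ t.*2) (exprS c t) mulrACA -exprMn.
  rewrite mulrAC (@collect _ _ (a ^+ 8 * c ^+ 3 * c) (a ^+ 8 * c ^+ 3 * c * c)).
  - by rewrite (exprMn t (a ^+ 8 * c ^+ 3 * c)); ring.
  - by ring.
  - by ring.
Qed.

(** * Products and theta series modulo a power of q *)

Section Truncation.

Variables (R : idomainType) (N : nat).
Implicit Types (a b p q : {poly R}) (f g : fps R) (m n k d t : nat).

Local Notation pi := (in_qpoly ('X^(N.+1) : {poly R})).

Lemma trunc_eqP p q : (forall i, (i <= N)%N -> p`_i = q`_i) <-> pi p = pi q.
Proof.
have piE r : pi r = take_poly N.+1 r :> {poly R}.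
  by rewrite /= mk_monic_Xn Pdiv.RingMonic.take_poly_rmodp.
split=> [eq_pq | eq_pq i le_iN].
  apply/val_inj/(etrans (piE p))/(etrans _ (esym (piE q))).
  apply/polyP => i; rewrite !coef_take_poly; case: ltnP => // /eq_pq; exact.
have /(congr1 (fun r : {poly R} => r`_i)) := congr1 (@polyn _ _) eq_pq.
by rewrite !piE !coef_take_poly ltnS le_iN.
Qed.

Lemma coef0X p k : p`_0 = 0 -> (0 < k)%N -> (p ^+ k)`_0 = 0.
Proof. by case: k => // k p0 _; rewrite exprS coef0M p0 mul0r. Qed.

Lemma trunc_exp p q k : q`_0 = 0 -> (N < k)%N -> pi (p * q ^+ k) = 0.
Proof.
move=> q0 lt_Nk; rewrite -(rmorph0 pi); apply/trunc_eqP => i le_iN.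
have -> : q = drop_poly 1 q * 'X.
  rewrite -[LHS](poly_take_drop 1) expr1 -[RHS]add0r; congr (_ + _).
  by apply/polyP => -[|j]; rewrite coef_take_poly coef0.
by rewrite exprMn mulrA coefMXn coef0 (leq_ltn_trans le_iN).
Qed.

(** A reciprocal of 1 - p modulo q^(N+1), when p has no constant term. *)
Definition geometric p : {poly R} := \sum_(i < N.+1) p ^+ i.

Lemma geometricK p : p`_0 = 0 -> pi (geometric p) * pi (1 - p) = 1.
Proof.
move=> p0; rewrite -rmorphM -opprB mulrN mulrC -subrX1 opprB.
by rewrite -[p ^+ _]mul1r rmorphB /= trunc_exp // rmorph1 subr0.
Qed.

(** The class of the infinite product (a; q)_oo: the factors that are left out
    do not matter modulo q^(N+1), see [tpochE]. *)
Definition tpoch a q := pi (qpoch_fin a q N.+1).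

Lemma tpochE a q m : q`_0 = 0 -> (N < m)%N -> pi (qpoch_fin a q m) = tpoch a q.
Proof.
move=> q0 lt_Nm; apply/trunc_eqP => i le_iN.
by rewrite !qpoch_fin_stable //; apply: leq_ltn_trans lt_Nm.
Qed.

Lemma tpoch_mulN a q : tpoch a q * tpoch (- a) q = tpoch (a ^+ 2) (q ^+ 2).
Proof.
rewrite -rmorphM; congr pi; rewrite -big_split; apply: eq_bigr => j _ /=.
by rewrite -exprM mulnC exprM; ring.
Qed.

Lemma tpoch_split d a q : (0 < d)%N -> q`_0 = 0 ->
  tpoch a q = \prod_(r < d) tpoch (a * q ^+ r) (q ^+ d).
Proof.
move=> d_gt0 q0; rewrite -(@tpochE a q (d * N.+1)) //; last first.
  by rewrite -[N in (N < _)%N]muln1; nia.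
rewrite -rmorph_prod; congr pi.
elim: N.+1 => [|m IHm].
  by rewrite muln0 /qpoch_fin big_ord0 big1 // => r _; rewrite big_ord0.
rewrite mulnS addnC /qpoch_fin big_split_ord /= -/(qpoch_fin a q _) IHm.
rewrite -big_split; apply: eq_bigr => r _ /=.
by rewrite [RHS]big_ord_recr /= exprD exprM; congr (_ * _); ring.
Qed.

Definition qpoch_inv a q : {poly R} := \prod_(j < N.+1) geometric (a * q ^+ j).

Lemma qpoch_invK a q : a`_0 = 0 -> pi (qpoch_inv a q) * tpoch a q = 1.
Proof.
move=> a0; rewrite -rmorphM -big_split rmorph_prod big1 // => j _ /=.
by rewrite rmorphM geometricK // coef0M a0 mul0r.
Qed.

Lemma theta_truncE a b m : a`_0 = 0 -> b`_0 = 0 -> (N < m)%N ->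
  pi (theta_trunc m a b) = pi (theta_trunc N.+1 a b).
Proof.
move=> a0 b0 /subnKC <-; elim: (m - _)%N => [|j IHj]; first by rewrite addn0.
rewrite -{}IHj addnS /theta_trunc 2!(big_ord_recr (N.+1 + j)) addrACA.
set s := _ + \sum_(t < _) _; rewrite !rmorphD -[RHS]addr0; congr (_ + _) => /=.
by rewrite [X in X + _]trunc_exp ?[X in _ + X]trunc_exp ?addr0 //; lia.
Qed.

(** Modulo q^(N+1), multiplication by (ab; ab)_oo turns the Gaussian binomial
    [2m, m + t] into 1 as soon as m + t and m - t both exceed N: it is
    (Q)_2m / ((Q)_(m+t) (Q)_(m-t)) with three equal q-factorials.  For m = 2(N+1)
    this covers every |t| <= N, and the other terms contain a^t or b^t with
    t > N, hence vanish. *)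
Lemma jacobi_triple_product a b : a`_0 = 0 -> b`_0 = 0 -> a * b != 0 ->
  tpoch (- a) (a * b) * tpoch (- b) (a * b) * tpoch (a * b) (a * b)
  = pi (theta_trunc N.+1 a b).
Proof.
move=> a0 b0 ab0; set q := a * b.
have [m Dm] : exists m, m = (N.+1 + N.+1)%N by eexists.
have q0 : q`_0 = 0 by rewrite coef0M a0 mul0r.
rewrite -(@theta_truncE a b m.+1) //; last by lia.
have lt_Nm : (N < m)%N by lia.
rewrite -(@tpochE (- a) q m) // -(@tpochE (- b) q m) //.
rewrite -(rmorphM pi (qpoch_fin _ _ m)).
rewrite (finite_triple_product m ab0) -/q.
have qbinom1 k j : (N < k)%N -> (N < j)%N ->
    pi (qbinom q (k + j) k) * tpoch q q = 1.
  move=> lt_Nk lt_Nj; have := congr1 pi (qbinom_factorial q k j).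
  rewrite !rmorphM /= !tpochE //; last by lia.
  move/(congr1 ( *%R (pi (qpoch_inv q q)))).
  by rewrite [_ * tpoch q q]mulrC mulrA qpoch_invK // mul1r.
have -> : theta_trunc m.+1 a b = \sum_(t < m.+1) q ^+ 'C(t, 2) * a ^+ t
    + \sum_(t < m) q ^+ 'C(t.+1, 2) * b ^+ t.+1 + q ^+ 'C(m.+1, 2) * b ^+ m.+1.
  by rewrite /theta_trunc [X in _ + X]big_ord_recr /= addrA.
rewrite [RHS]rmorphD /= [X in _ = _ + X]trunc_exp ?addr0 //; last by lia.
rewrite !rmorphD mulrDl; congr (_ + _); rewrite !rmorph_sum mulr_suml.
  apply: eq_bigr => t _ /=; rewrite rmorphM /= mulrAC.
  have [lt_Nt | le_tN] := ltnP N t; first by rewrite trunc_exp // mulr0.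
  by rewrite (_ : m + m = m + t + (m - t))%N ?qbinom1 ?mul1r //; lia.
apply: eq_bigr => t _ /=; rewrite rmorphM /= mulrAC.
have [lt_Nt | le_tN] := ltnP N t.+1; first by rewrite trunc_exp // mulr0.
by rewrite (_ : m + m = m - t.+1 + (m + t.+1))%N ?qbinom1 ?mul1r //; lia.
Qed.

End Truncation.

Section TruncatedSeries.

Variables (R : idomainType) (N : nat).
Implicit Types (a q : {poly R}) (f g : fps R) (m : nat).

Local Notation pi := (in_qpoly ('X^(N.+1) : {poly R})).

Definition tfps f := pi (\poly_(i < N.+1) f i).

Lemma tfpsM f g : tfps (fps_mul f g) = tfps f * tfps g.
Proof.
rewrite -rmorphM; apply/trunc_eqP => i le_iN.
rewrite coef_poly ltnS le_iN coefM; apply: eq_bigr => j _.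
by rewrite !coef_poly !ltnS; case: j => j /= lt_ji; rewrite !ifT //; lia.
Qed.

Lemma tfps1 : tfps (@fps_one R) = 1.
Proof.
rewrite -(rmorph1 pi); apply/trunc_eqP => i le_iN.
by rewrite coef_poly coef1 ltnS le_iN.
Qed.

Lemma tfpsX f m : tfps (fps_exp f m) = tfps f ^+ m.
Proof. by elim: m => [|m IHm]; rewrite ?tfps1 // (exprS (tfps f)) -IHm -tfpsM. Qed.

Lemma tfps_divK f g : g 0%N \is a GRing.unit ->
  tfps (fps_div f g) * tfps g = tfps f.
Proof.
move=> Ug; rewrite tfpsM -mulrA [_ * tfps g]mulrC -tfpsM -[RHS]mulr1 -tfps1.
congr (_ * pi _); apply/polyP => i.
by rewrite !coef_poly fps_mulfV.
Qed.

Lemma tfps_qpoch a q : q`_0 = 0 -> tfps (qpoch a q) = tpoch N a q.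
Proof.
move=> q0; apply/trunc_eqP => i le_iN.
by rewrite coef_poly ltnS le_iN qpoch_fin_stable.
Qed.

End TruncatedSeries.

(** * Polynomials with nonnegative coefficients *)

Section Positivity.

Variable R : numDomainType.
Implicit Types p q : {poly R}.

Definition coef_ge0 p := forall i, 0 <= p`_i.

Lemma coef_ge0D p q : coef_ge0 p -> coef_ge0 q -> coef_ge0 (p + q).
Proof. by move=> p0 q0 i; rewrite coefD addr_ge0. Qed.

Lemma coef_ge0M p q : coef_ge0 p -> coef_ge0 q -> coef_ge0 (p * q).
Proof. by move=> p0 q0 i; rewrite coefM sumr_ge0 // => j _; rewrite mulr_ge0. Qed.

Lemma coef_ge01 : coef_ge0 1.
Proof. by move=> i; rewrite coef1 ler0n. Qed.

Lemma coef_ge0X p k : coef_ge0 p -> coef_ge0 (p ^+ k).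
Proof.
move=> p0; elim: k => [|k IHk]; first exact: coef_ge01.
by rewrite exprS; apply: coef_ge0M.
Qed.

Lemma coef_ge0_polyXn k : coef_ge0 'X^k.
Proof. by move=> i; rewrite coefXn ler0n. Qed.

Lemma coef_ge0_sum (I : Type) (s : seq I) (P : pred I) (F : I -> {poly R}) :
  (forall i, P i -> coef_ge0 (F i)) -> coef_ge0 (\sum_(i <- s | P i) F i).
Proof. by move=> F0 k; rewrite coef_sum sumr_ge0 // => i /F0. Qed.

Lemma coef_ge0_prod (I : Type) (s : seq I) (P : pred I) (F : I -> {poly R}) :
  (forall i, P i -> coef_ge0 (F i)) -> coef_ge0 (\prod_(i <- s | P i) F i).
Proof.
move=> F0; apply: (big_ind coef_ge0) => //; first exact: coef_ge01.
exact: coef_ge0M.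
Qed.

Lemma coefM_gt0 p q i j : coef_ge0 p -> coef_ge0 q ->
  0 < p`_i -> 0 < q`_j -> 0 < (p * q)`_(i + j).
Proof.
move=> p0 q0 pi_gt0 qj_gt0; have lt_i : (i < (i + j).+1)%N by lia.
rewrite coefM (bigD1 (Ordinal lt_i)) //= addKn ltr_wpDr ?mulr_gt0 //.
by rewrite sumr_ge0 // => k _; rewrite mulr_ge0.
Qed.

Lemma coef_comp_polyNX2 p n :
  (p \Po (- 'X^2))`_n = if odd n then 0 else (-1) ^+ n./2 * p`_n./2.
Proof.
have -> : p \Po (- 'X^2) = (p \Po (- 'X)) \Po 'X^2.
  by rewrite -comp_polyA rmorphN /= comp_polyX.
rewrite coef_comp_poly_Xn // dvdn2; case: odd => //=; rewrite divn2.
move: n./2 => m; rewrite coef_comp_poly.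
under eq_bigr => i _.
  rewrite -scaleN1r exprZn coefZ coefXn; over.
have [lt_m | le_m] := ltnP m (size p).
  rewrite (bigD1 (Ordinal lt_m)) //= eqxx mulr1 mulrC big1 ?addr0 // => i.
  by rewrite -val_eqE /= eq_sym => /negPf->; rewrite !mulr0.
rewrite (nth_default _ le_m) mulr0 big1 // => i _.
by rewrite gtn_eqF ?mulr0 //; apply: leq_trans le_m.
Qed.

End Positivity.

(** * The even and odd parts of the quotient *)

Section Quotients.

Variable N : nat.
Implicit Types (a q z : {poly int}) (k r m : nat).
Local Notation pi := (in_qpoly ('X^(N.+1) : {poly int})).

Lemma geometric_ge0 a : coef_ge0 a -> coef_ge0 (geometric N a).
Proof. by move=> a0; apply: coef_ge0_sum => i _; apply: coef_ge0X. Qed.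

Lemma coef0_geometric a : a`_0 = 0 -> (geometric N a)`_0 = 1.
Proof.
move=> a0; rewrite /geometric big_ord_recl expr0 coefD coef1 coef_sum big1 ?addr0 //.
by move=> i _; apply: coef0X.
Qed.

Lemma qpoch_inv_ge0 a q : coef_ge0 a -> coef_ge0 q -> coef_ge0 (qpoch_inv N a q).
Proof.
move=> a0 q0; apply: coef_ge0_prod => j _.
by apply/geometric_ge0/coef_ge0M/coef_ge0X.
Qed.

Lemma coef0_prod (I : Type) (s : seq I) (P : pred I) (F : I -> {poly int}) :
  (\prod_(i <- s | P i) F i)`_0 = \prod_(i <- s | P i) (F i)`_0.
Proof.
apply: (big_morph (fun p : {poly int} => p`_0)) => [p q|]; first exact: coef0M.
by rewrite coef1.
Qed.

Lemma coef0_qpoch_inv a q : a`_0 = 0 -> (qpoch_inv N a q)`_0 = 1.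
Proof.
move=> a0; rewrite coef0_prod big1 // => j _.
by rewrite coef0_geometric // coef0M a0 mul0r.
Qed.

Lemma qpoch_inv_comp a q z :
  qpoch_inv N a q \Po z = qpoch_inv N (a \Po z) (q \Po z).
Proof.
rewrite rmorph_prod; apply: eq_bigr => j _; rewrite rmorph_sum /=.
by apply: eq_bigr => i _; rewrite !(rmorphXn, rmorphM).
Qed.

Lemma theta_trunc_comp m a b z :
  theta_trunc m a b \Po z = theta_trunc m (a \Po z) (b \Po z).
Proof.
rewrite rmorphD !rmorph_sum; congr (_ + _); apply: eq_bigr => i _ /=;
  by rewrite !(rmorphXn, rmorphM).
Qed.

(** The series G_k, given as a product of series with nonnegative coefficients;
    [quotient_series_comp] shows that it is
    phi(z) f(-z^k, -z^(8-k)) / ((z; z)_oo (z^4; z^4)_oo). *)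
Definition quotient_series k : {poly int} :=
  theta_trunc N.+1 'X 'X
  * \prod_(r <- iota 1 7 | (r != k) && (r != 8 - k)%N) qpoch_inv N 'X^r 'X^8
  * qpoch_inv N 'X^4 'X^4.

(** (z; z)_oo is the product of the (z^r; z^8)_oo for 1 <= r <= 8; the factors
    with r different from k, 8 - k and 8 cancel against the reciprocals in G_k,
    and the remaining three are a triple product.  The value k = 4 is excluded
    because k and 8 - k would then be the same residue. *)
Lemma quotient_series_comp k z : k \in [:: 1; 2; 3; 5; 6; 7]%N -> z`_0 = 0 -> z != 0 ->
  pi (quotient_series k \Po z) * tpoch N z z * tpoch N (z ^+ 4) (z ^+ 4)
  = pi (theta_trunc N.+1 z z)
    * pi (theta_trunc N.+1 (- z ^+ k) (- z ^+ (8 - k))).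
Proof.
move=> k_in z0 z_neq0.
have k_lt8 : (0 < k < 8)%N by apply: (@allP _ (fun k => 0 < k < 8)%N _ _ _ k_in).
have zX r : (0 < r)%N -> (z ^+ r)`_0 = 0 by apply: coef0X.
have zN r : (0 < r)%N -> (- z ^+ r)`_0 = 0 by move=> ?; rewrite coefN zX ?oppr0.
have z8 : - z ^+ k * - z ^+ (8 - k) = z ^+ 8 by rewrite mulrNN -exprD subnKC //; lia.
rewrite -(@jacobi_triple_product _ N (- z ^+ k)) ?z8 ?expf_neq0 ?zN //; try lia.
rewrite !opprK.
rewrite !rmorphM /= theta_trunc_comp comp_polyX rmorph_prod.
under eq_bigr => r _ do rewrite /= qpoch_inv_comp !comp_Xn_poly.
rewrite qpoch_inv_comp !comp_Xn_poly rmorph_prod /=.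
rewrite (@tpoch_split _ _ 8 z z) //.
under [X in _ * X * _ = _]eq_bigr => r _ do rewrite -exprS.
pose T r := tpoch N (z ^+ r) (z ^+ 8).
have split8 : \prod_(r < 8) T r.+1
    = \prod_(r <- iota 1 7 | (r != k) && (r != 8 - k)%N) T r
      * (T k * T (8 - k)%N) * T 8.
  rewrite /= !big_ord_recl big_ord0 !big_cons big_nil /= /bump /=.
  move: T k_in => T; rewrite !inE.
  repeat (case/predU1P => [->|]; first by rewrite /=; ring).
  by move/eqP->; rewrite /=; ring.
have cancel : \prod_(r <- iota 1 7 | (r != k) && (r != 8 - k)%N)
      pi (qpoch_inv N (z ^+ r) (z ^+ 8))
    * \prod_(r <- iota 1 7 | (r != k) && (r != 8 - k)%N) T r = 1.
  rewrite -big_split big1_seq // => r /andP[_ r_in] /=.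
  by rewrite qpoch_invK // zX //; move: r_in; rewrite mem_iota; lia.
have cancel4 : pi (qpoch_inv N (z ^+ 4) (z ^+ 4)) * tpoch N (z ^+ 4) (z ^+ 4) = 1.
  by rewrite qpoch_invK // zX.
rewrite -/(T k) -/(T _) -/(T 8) [X in _ * _ * _ * X * _]split8.
set Inv := \prod_(r <- _ | _) _ in cancel *.
set Prd := \prod_(r <- _ | _) _ in cancel *.
set I4 := pi (qpoch_inv _ _ _) in cancel4 *.
set T4 := tpoch _ (z ^+ 4) (z ^+ 4) in cancel4 *.
transitivity ((Inv * Prd) * (I4 * T4) * (pi (theta_trunc N.+1 z z)
   * (T k * T (8 - k)%N * T 8))); first by ring.
by rewrite cancel cancel4 !mul1r.
Qed.

Lemma theta_trunc_ge0 m a b : coef_ge0 a -> coef_ge0 b -> coef_ge0 (theta_trunc m a b).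
Proof.
move=> a0 b0; apply: coef_ge0D; apply: coef_ge0_sum => i _; apply: coef_ge0M;
  by apply: coef_ge0X => //; apply: coef_ge0M.
Qed.

Lemma theta_gt0 i : (i < 2)%N -> 0 < (theta_trunc N.+1 'X 'X : {poly int})`_i.
Proof.
have X0 : coef_ge0 ('X : {poly int}) by rewrite -['X]expr1; apply: coef_ge0_polyXn.
have XX0 : coef_ge0 ('X * 'X : {poly int}) by apply: coef_ge0M.
case: i => [|[|//]] _; rewrite /theta_trunc coefD.
  rewrite ltr_wpDr //.
    by apply: coef_ge0_sum => i _; apply: coef_ge0M; apply: coef_ge0X.
  rewrite big_ord_recl bin0n !expr0 mulr1 coefD coef1 ltr_wpDr //.
  by apply: coef_ge0_sum => i _; apply: coef_ge0M; apply: coef_ge0X.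
rewrite ltr_wpDl //.
  by apply: coef_ge0_sum => i _; apply: coef_ge0M; apply: coef_ge0X.
rewrite big_ord_recl (_ : 'C(1, 2) = 0)%N // expr0 mul1r expr1 coefD coefX ltr_wpDr //.
by apply: coef_ge0_sum => i _; apply: coef_ge0M; apply: coef_ge0X.
Qed.

(** The factor 1 / (1 - q^r) alone has positive coefficients at the multiples of r.
    As r <= 2, the coefficients of index 0 and 1 of phi are enough to reach the
    other residues modulo r. *)
Lemma quotient_series_gt0 k r m :
    r \in iota 1 2 -> r != k -> r != (8 - k)%N -> (m <= N)%N ->
  0 < (quotient_series k)`_m.
Proof.
move=> r_in r_k r_k' le_mN; have r_gt0 : (0 < r)%N by move: r_in; rewrite mem_iota; lia.
rewrite /quotient_series -big_filter (bigD1_seq r) ?filter_uniq ?iota_uniq //;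
  last first.
  by rewrite mem_filter r_k r_k' mem_iota; move: r_in; rewrite mem_iota; lia.
have inv_ge0 s t : coef_ge0 (qpoch_inv N 'X^s 'X^t : {poly int}).
  by apply: qpoch_inv_ge0; apply: coef_ge0_polyXn.
have Xn0 s : (0 < s)%N -> ('X^s : {poly int})`_0 = 0.
  by case: s => // s _; rewrite coefXn.
rewrite {1}/qpoch_inv big_ord_recl expr0 mulr1.
set A := \prod_(j < N) _; set B := \prod_(i <- _ | _) _.
have A_ge0 : coef_ge0 A.
  apply: coef_ge0_prod => j _; apply: geometric_ge0.
  by apply: coef_ge0M; [|apply: coef_ge0X]; apply: coef_ge0_polyXn.
have A0 : A`_0 = 1.
  rewrite coef0_prod big1 // => j _.
  by rewrite coef0_geometric // coef0M Xn0 ?mul0r.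
have B_ge0 : coef_ge0 B by apply: coef_ge0_prod => s _.
have B0 : B`_0 = 1.
  rewrite coef0_prod big_filter_cond big1_seq // => s /andP[_ s_in].
  by rewrite coef0_qpoch_inv // Xn0 //; move: s_in; rewrite mem_iota; lia.
(* The factor 1 / (1 - q^r) is brought to the front and contributes the index
   r * (m %/ r); the other factors contribute the index m %% r < 2. *)
rewrite mulrA -!mulrA mulrCA (divn_eq m r).
have X0 : coef_ge0 ('X : {poly int}) by apply: (coef_ge0_polyXn _ 1).
have theta_ge0 := theta_trunc_ge0 N.+1 X0 X0.
apply: coefM_gt0.
- by apply: geometric_ge0; apply: coef_ge0_polyXn.
- by do !apply: coef_ge0M.
- have lt_j : (m %/ r < N.+1)%N by rewrite ltnS (leq_trans (leq_div _ _)).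
  rewrite coef_sum (bigD1 (Ordinal lt_j)) //= -exprM coefXn mulnC eqxx ltr_wpDr //.
  by rewrite sumr_ge0 // => j _; rewrite -exprM coefXn ler0n.
rewrite -[(m %% r)%N]addn0; apply: coefM_gt0 => //.
- by do !apply: coef_ge0M.
- by apply: theta_gt0; have := ltn_pmod m r_gt0; move: r_in; rewrite mem_iota; lia.
by rewrite !coef0M A0 B0 coef0_qpoch_inv ?Xn0.
Qed.

Local Notation poch := (@tpoch int N).

(** With z = -q^2, the ingredients are phi(z) = (q^2; q^4)^2 f_4,
    f(-q, -q^3) = (q; q^2) f_4 and f_4^3 = (z; z) f_8 f_2, where all products are
    infinite; the last one follows from (q^2; q^4)(-q^2; q^4) = (q^4; q^8). *)
Lemma eta_quotient_dissection :
  pi (quotient_series 3 \Po (- 'X^2) - 'X * (quotient_series 7 \Po (- 'X^2)))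
    * poch 'X^4 'X^4 ^+ 3
  = poch 'X 'X * poch 'X^2 'X^2 ^+ 2.
Proof.
have Xn0 s : (0 < s)%N -> ('X^s : {poly int})`_0 = 0.
  by case: s => // s _; rewrite coefXn.
have X0 : ('X : {poly int})`_0 = 0 by rewrite coefX.
pose z : {poly int} := - 'X^2.
have z0 : z`_0 = 0 by rewrite coefN coefXn oppr0.
have z_neq0 : z != 0 by rewrite oppr_eq0 expf_neq0 // polyX_eq0.
have parity a q : q`_0 = 0 -> poch a q = poch a (q ^+ 2) * poch (a * q) (q ^+ 2).
  by move=> q0; rewrite (@tpoch_split _ _ 2) // big_ord_recl big_ord1 expr0 mulr1 expr1.
have E3 := @quotient_series_comp 3 z isT z0 z_neq0.
have E7 := @quotient_series_comp 7 z isT z0 z_neq0.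
have theta_z := @jacobi_triple_product _ N z z z0 z0 (mulf_neq0 z_neq0 z_neq0).
have NX0 : (- 'X : {poly int})`_0 = 0 by rewrite coefN X0 oppr0.
have NXX0 : (- 'X * 'X^2 : {poly int})`_0 = 0 by rewrite coef0M NX0 mul0r.
have theta_X : poch 'X 'X^4 * poch 'X^3 'X^4 * poch 'X^4 'X^4
    = pi (theta_trunc N.+1 (- 'X) (- 'X * 'X^2)).
  rewrite -jacobi_triple_product ?NX0 ?NXX0 //; last first.
    by rewrite !(mulf_neq0, expf_neq0, oppr_eq0) ?polyX_eq0.
  have -> : - 'X * (- 'X * 'X^2) = 'X^4 :> {poly int} by ring.
  by rewrite opprK mulNr opprK -exprS.
have dissection : pi (theta_trunc N.+1 (- 'X) (- 'X * 'X^2))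
    = pi (theta_trunc N.+1 (- z ^+ 3) (- z ^+ 5))
      - pi 'X * pi (theta_trunc N.+1 (- z ^+ 7) (- z ^+ 1)).
  rewrite -(@theta_truncE _ _ (- 'X) _ (N.+1).*2) ?NX0 ?NXX0 //; last by lia.
  rewrite theta_trunc_dissection rmorphD rmorphM rmorphN mulNr /=.
  by congr (pi (theta_trunc _ _ _) - _ * pi (theta_trunc _ _ _)); rewrite /z; ring.
have f1E : poch 'X 'X = poch 'X 'X^2 * poch 'X^2 'X^2.
  by rewrite parity.
have f2E : poch 'X^2 'X^2 = poch 'X^2 'X^4 * poch 'X^4 'X^4.
  by rewrite parity ?Xn0 // -exprM -exprD.
have f4E : poch 'X^4 'X^4
    = poch 'X^2 'X^4 * poch (- 'X^2) 'X^4 * poch 'X^8 'X^8.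
  by rewrite parity ?Xn0 // tpoch_mulN -!exprM -exprD.
have o1E : poch 'X 'X^2 = poch 'X 'X^4 * poch 'X^3 'X^4.
  by rewrite parity ?Xn0 // -exprM -exprS.
have zz : z * z = 'X^4 by rewrite /z; ring.
have gE : poch z z = poch (- 'X^2) 'X^4 * poch 'X^4 'X^4.
  by rewrite parity // expr2 zz.
have z4 : z ^+ 4 = 'X^8 by rewrite /z; ring.
rewrite zz [- z]opprK in theta_z.
rewrite z4 -theta_z in E3 E7.
rewrite -theta_X -o1E in dissection.
have f4cube : poch 'X^4 'X^4 ^+ 3
    = poch z z * poch 'X^8 'X^8 * poch 'X^2 'X^2.
  by rewrite (exprS (poch _ _)) gE f2E {1}f4E; ring.
rewrite rmorphB /= [pi ('X * _)]rmorphM /= -/z f4cube.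
set h3 := pi (quotient_series 3 \Po z) in E3 *.
set h7 := pi (quotient_series 7 \Po z) in E7 *.
set x := pi 'X in dissection *.
move: h3 h7 x E3 E7 dissection => h3 h7 x E3 E7 D.
transitivity ((h3 * poch z z * poch 'X^8 'X^8
               - x * (h7 * poch z z * poch 'X^8 'X^8)) * poch 'X^2 'X^2).
  by ring.
rewrite E3 E7 f1E.
transitivity (poch 'X^2 'X^4 * poch 'X^2 'X^4 * poch 'X^4 'X^4 *
  (poch 'X 'X^2 * poch 'X^4 'X^4) * poch 'X^2 'X^2).
  by rewrite D; ring.
by rewrite f2E; ring.
Qed.

End Quotients.

Lemma coef_signed_dissection (p q : {poly int}) n :
  (p \Po (- 'X^2) - 'X * (q \Po (- 'X^2)))`_n
  = (-1) ^+ n./2 * (if odd n then - q`_n./2 else p`_n./2).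
Proof.
rewrite coefB coefXM !coef_comp_polyNX2.
case: n => [|n] /=; first by rewrite subr0.
by rewrite uphalf_half; case: (odd n) => /=; rewrite ?subr0 ?sub0r ?mulrN.
Qed.

Theorem theorem1p3 (C : fps int)
  (hC : (\qpoch('X; 'X) * \qpoch('X^2; 'X^2) ^+ 2 /
         \qpoch('X^4; 'X^4) ^+ 3)%fps =1 C)
  (n : nat) :
  ((n = 0 %[mod 4])%N \/ (n = 3 %[mod 4])%N -> Num.sg (C n) = 1) /\
  ((n = 1 %[mod 4])%N \/ (n = 2 %[mod 4])%N -> Num.sg (C n) = -1).
Proof.
have Xn0 s : (0 < s)%N -> ('X^s : {poly int})`_0 = 0.
  by case: s => // s _; rewrite coefXn.
have X0 : ('X : {poly int})`_0 = 0 by rewrite coefX.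
pose E := quotient_series n 3; pose O := quotient_series n 7.
have coefC : C n = (E \Po (- 'X^2) - 'X * (O \Po (- 'X^2)))`_n.
  have coef_tfps : C n = (\poly_(i < n.+1) C i)`_n by rewrite coef_poly ltnSn.
  rewrite coef_tfps; apply: (iffRL (trunc_eqP n _ _)) (leqnn n).
  pose u := in_qpoly ('X^(n.+1) : {poly int}) (qpoch_inv n 'X^4 'X^4).
  have fK : u * tpoch n 'X^4 'X^4 = 1 by rewrite qpoch_invK ?Xn0.
  have cancel x : x * tpoch n 'X^4 'X^4 ^+ 3 * u ^+ 3 = x.
    by rewrite -mulrA -exprMn [_ * u]mulrC fK expr1n mulr1.
  suff eqC : tfps n C * tpoch n 'X^4 'X^4 ^+ 3 = tpoch n 'X 'X * tpoch n 'X^2 'X^2 ^+ 2.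
    rewrite -eta_quotient_dissection in eqC.
    by rewrite -/(tfps n C) -[LHS]cancel eqC cancel.
  have -> : tfps n C
      = tfps n (fps_div (fps_mul (qpoch 'X 'X) (fps_exp (qpoch 'X^2 'X^2) 2))
                        (fps_exp (qpoch 'X^4 'X^4) 3)).
    by congr in_qpoly; apply/polyP => i; rewrite !coef_poly hC.
  rewrite -(tfps_qpoch n 'X^4) ?Xn0 // -tfpsX tfps_divK; last first.
    by rewrite /fps_exp /= /fps_mul !big_ord1 !qpoch0 ?Xn0 // !mul1r.
  by rewrite tfpsM tfpsX !tfps_qpoch ?Xn0.
have posE m : (m <= n)%N -> 0 < E`_m by apply: (@quotient_series_gt0 n 3 1).
have posO m : (m <= n)%N -> 0 < O`_m by apply: (@quotient_series_gt0 n 7 2).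
move: (odd_double_half n) (posE n./2) (posO n./2).
rewrite coefC coef_signed_dissection; set m := n./2 => Dn posEm posOm.
have {posEm posOm} [E_gt0 O_gt0] : 0 < E`_m /\ 0 < O`_m.
  by split; [apply: posEm | apply: posOm]; lia.
rewrite -(signr_odd _ m).
case: (odd n) Dn => Dn; case: (odd m) (odd_double_half m) => Dm; split=> n_mod4;
  try (exfalso; lia);
  by rewrite ?mulN1r ?mul1r ?sgrN gtr0_sg ?opprK.
Qed.
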